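(* Suppose the stochastic basis $\psi_1,\dots,\psi_K$ satisfies property (P1): there is an orthogonal matrix $V\in\mathbb{R}^{K\times K}$, independent of $\hat v$, such that for every $\hat v\in\mathbb{R}^K$, $\mathcal{P}(\hat v)=V\Lambda_{\hat v}V^T$ with $\Lambda_{\hat v}$ diagonal. Fix $\hat b\in\mathbb{R}^K$ and define, for all $(\hat h,\hat q)\in\mathbb{R}^K\times\mathbb{R}^K$ with $\mathcal{P}(\hat h)$ positive definite, with $\hat v=\mathcal{P}^{-1}(\hat h)\hat q$, $$\hat\eta=\tfrac12\big(\hat q^T\mathcal{P}^{-1}(\hat h)\hat q+g\,\hat h^T\hat h\big)+g\,\hat h^T\hat b,\qquad \hat H=\tfrac12\hat v^T\mathcal{P}(\hat q)\hat v+g\,\hat q^T\hat h+g\,\hat q^T\hat b,$$ and, with $\hat\alpha=\hat h^{1/2}$ a solution of $\mathcal{P}(\hat\alpha)\hat\alpha=\hat h$ and $\hat\beta=\mathcal{P}^{-1}(\hat\alpha)\hat q$, $$\hat\eta_{\mathrm{Roe}}=\tfrac12\big(g\,\hat\alpha^T\mathcal{P}(\hat\alpha)^T\mathcal{P}(\hat\alpha)\hat\alpha+\hat\beta^T\hat\beta\big)+g\,\hat\alpha^T\mathcal{P}(\hat\alpha)\hat b,$$ $$\hat H_{\mathrm{Roe}}=\tfrac12\hat\beta^T\mathcal{P}(\hat\beta)\mathcal{P}^{-1}(\hat\alpha)\hat\beta+g\,\hat\alpha^T\mathcal{P}(\hat\alpha)^2\hat\beta+g\,\hat\beta^T\mathcal{P}(\hat\alpha)\hat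 b .$$ Then, as functions of the conservative variables $(\hat h,\hat q)$, $\hat\eta=\hat\eta_{\mathrm{Roe}}$ and $\hat H=\hat H_{\mathrm{Roe}}$. Consequently the entropy variables and the entropy potentials associated with the two entropy–entropy flux pairs are identical as well.
   Context: Let $\rho$ be a probability density on $\mathbb{R}^n$, $\langle y,z\rangle=\int_{\mathbb{R}^n}y(s)z(s)\rho(s)\,ds$, and let $\psi_1,\dots,\psi_K$ be real functions, orthonormal with respect to $\langle\cdot,\cdot\rangle$, with finite triple products. The stochastic Galerkin matrix of $\hat v\in\mathbb{R}^K$ is the symmetric $K\times K$ matrix with entries $[\mathcal{P}(\hat v)]_{ij}=\sum_{k=1}^K\hat v_k\langle\psi_i\psi_j,\psi_k\rangle$; it satisfies $\mathcal{P}(\hat v)\hat w=\mathcal{P}(\hat w)\hat v$. $\mathcal{P}^{-1}(\hat v)$ denotes $(\mathcal{P}(\hat v))^{-1}$. $g>0$ is the gravitational constant. It is assumed throughout that a solution $\hat\alpha$ of $\mathcal{P}(\hat\alpha)\hat\alpha=\hat h$ exists and that the inverses appearing exist. Entropy variables and potentials: with $\hat u=(\hat h,\hat q)$, the entropy variables are the gradients with respect to the conservative variables (with $\hat b$ fixed), $\hat w=(\partial\hat\eta/\partial\hat u)^T$ and $\hat w_{\mathrm{Roe}}=(\partial\hat\eta_{\mathrm{Roe}}/\partial\hat u)^T$. The entropy potentials are $\Phi=\hat w\cdot\hat F-\hat H$ and $\Phi_{\mathrm{Roe}}=\hat w_{\mathrm{Roe}}\cdot\hat F_{\mathrm{Roe}}-\hat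 H_{\mathrm{Roe}}$, with the flux functions $$\hat F=\begin{pmatrix}\hat q\\ \mathcal{P}(\hat q)\mathcal{P}^{-1}(\hat h)\hat q+\tfrac12 g\,\mathcal{P}(\hat h)\hat h\end{pmatrix},\qquad \hat F_{\mathrm{Roe}}=\begin{pmatrix}\hat q\\ \mathcal{P}\big(\mathcal{P}^{-1}(\hat\alpha)\hat q\big)\mathcal{P}^{-1}(\hat\alpha)\hat q+\tfrac12 g\,\mathcal{P}\big(\mathcal{P}(\hat\alpha)\hat\alpha\big)\mathcal{P}(\hat\alpha)\hat\alpha\end{pmatrix}.$$ *)

(* Defs.v *)
From HB Require Import structures.
From mathcomp Require Import all_boot all_order all_algebra.
From mathcomp Require Import all_classical all_reals all_analysis.

Set Implicit Arguments.
Unset Strict Implicit.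
Unset Printing Implicit Defensive.

Import Order.TTheory GRing.Theory Num.Theory.
Import numFieldNormedType.Exports.

Local Open Scope classical_set_scope.
Local Open Scope ring_scope.

(* [measurableTypeR R] is [R] with its Borel sigma-algebra. *)
Notation euclidean R n := (n.-tuple (measurableTypeR R)).

Lemma sigma_finite_product d1 d2 (T1 : measurableType d1)
    (T2 : measurableType d2) (R : realType)
    (m1 : {sigma_finite_measure set T1 -> \bar R})
    (m2 : {sigma_finite_measure set T2 -> \bar R}) :
  sigma_finite setT (m1 \x m2)%E.
Proof.
have /sigma_finiteP[F [TF ndF Foo]] := sigma_finiteT m1.
have /sigma_finiteP[G [TG ndG Goo]] := sigma_finiteT m2.
exists (fun n => F n `*` G n).
  rewrite -setXTT TF TG predeqE => -[x y]; split.
    move=> [/= [n _ Fnx] [k _ Gky]]; exists (maxn n k) => //; split.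
    - by move: x Fnx; exact/subsetPset/ndF/leq_maxl.
    - by move: y Gky; exact/subsetPset/ndG/leq_maxr.
  by move=> [n _ []/= ? ?]; split; exists n.
move=> k; have [? ?] := Foo k; have [? ?] := Goo k.
split; first exact: measurableX.
by rewrite product_measure1E// lte_mul_pinfty// ge0_fin_numE.
Qed.

Section lebesgue_tuple.
Context {R : realType}.

Section step.
Variables (n : nat) (m : {sigma_finite_measure set (euclidean R n) -> \bar R}).

Definition tuple_cons (p : measurableTypeR R * euclidean R n) :
  euclidean R n.+1 := [tuple of p.1 :: p.2].

Lemma measurable_tuple_cons : measurable_fun setT tuple_cons.
Proof. exact: measurable_cons. Qed.

Definition lebesgue_step : set (euclidean R n.+1) -> \bar R :=
  pushforward (@lebesgue_measure R \x m)%E tuple_cons.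

Let mcons := measurable_tuple_cons.

Let lebesgue_step0 : lebesgue_step set0 = 0%E.
Proof. exact: (measure0 (pushforward _ tuple_cons)). Qed.

Let lebesgue_step_ge0 A : (0 <= lebesgue_step A)%E.
Proof. exact: (measure_ge0 (pushforward _ tuple_cons)). Qed.

Let lebesgue_step_sigma_additive : semi_sigma_additive lebesgue_step.
Proof. exact: (@measure_semi_sigma_additive _ _ _ (pushforward _ tuple_cons)). Qed.

HB.instance Definition _ := isMeasure.Build _ _ _ lebesgue_step
  lebesgue_step0 lebesgue_step_ge0 lebesgue_step_sigma_additive.

Let lebesgue_step_sigma_finite : sigma_finite setT lebesgue_step.
Proof.
have [F FT Ffin] := sigma_finite_product (@lebesgue_measure R) m.
pose split_tuple (t : euclidean R n.+1) : measurableTypeR R * euclidean R n :=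
  (thead t, [tuple of behead t]).
have consK : cancel tuple_cons split_tuple.
  by case=> x t; rewrite /split_tuple theadE; congr pair; exact: val_inj.
have msplit : measurable_fun setT split_tuple.
  apply: measurable_fun_pair; last exact: measurable_behead.
  exact: measurable_tnth.
exists (fun k => split_tuple @^-1` F k).
  by rewrite -preimage_bigcup -FT preimage_setT.
move=> k; have [mF Fk] := Ffin k; split.
  by rewrite -[X in measurable X]setTI; exact: msplit.
rewrite /lebesgue_step /pushforward -comp_preimage.
by rewrite (_ : split_tuple \o tuple_cons = id)//; apply/funext => p /=;
   rewrite consK.
Qed.

HB.instance Definition _ :=
  Measure_isSigmaFinite.Build _ _ _ lebesgue_step lebesgue_step_sigma_finite.

End step.

(* Lebesgue measure on R^n, as the iterated product of the one on R. *)
Fixpoint lebesgue_tuple n : {sigma_finite_measure set (euclidean R n) -> \bar R} :=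
  if n is n'.+1 then lebesgue_step (lebesgue_tuple n')
  else \d_([tuple] : euclidean R 0).

Lemma lebesgue_tuple_box n (A : 'I_n -> set (measurableTypeR R)) :
  (forall i, measurable (A i)) ->
  lebesgue_tuple n [set t | forall i, A i (tnth t i)] =
  (\prod_(i < n) lebesgue_measure (A i))%E.
Proof.
elim: n A => [|n IH] A mA /=.
  by rewrite big_ord0 diracE mem_set// => -[].
pose B := [set t : euclidean R n | forall i, A (lift ord0 i) (tnth t i)].
have mB : measurable B.
  have -> : B = \bigcap_(i in [set: 'I_n])
      ((fun t : euclidean R n => tnth t i) @^-1` A (lift ord0 i)).
    by apply/seteqP; split => t /= At i => [_|]; exact: At.
  apply: fin_bigcap_measurable => // i _.
  by rewrite -[X in measurable X]setTI; exact: measurable_tnth.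
have AB : tuple_cons (n := n) @^-1` [set t | forall i, A i (tnth t i)] =
    A ord0 `*` B.
  apply/seteqP; split => -[x t] /=.
    move=> At; split; first by have := At ord0.
    by move=> i; have := At (lift ord0 i); rewrite tnthS.
  case=> Ax At i; case: (unliftP ord0 i) => [j ->|->//].
  by rewrite tnthS; exact: At.
rewrite big_ord_recl /lebesgue_step /pushforward AB.
by rewrite product_measure1E// (IH (fun i => A (lift ord0 i))).
Qed.

End lebesgue_tuple.

Section galerkin.
Context {R : realType} (n : nat).
Local Notation mu := (@lebesgue_tuple R n).
Implicit Types (rho y z : euclidean R n -> R).

Definition probability_density rho :=
  [/\ measurable_fun setT rho, (forall s, 0 <= rho s)
    & (\int[mu]_s (rho s)%:E = 1)%E].

Definition inner_prod rho y z : R := \int[mu]_s (y s * z s * rho s).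

Variable K : nat.
Implicit Types (psi : 'I_K -> euclidean R n -> R).

(* [Rintegral] is total, so that the integrals have to be required to exist. *)
Definition orthonormal_basis rho psi :=
  [/\ (forall i, measurable_fun setT (psi i)),
      (forall i j, mu.-integrable setT
         (fun s => (psi i s * psi j s * rho s)%:E))
    & (forall i j, inner_prod rho (psi i) (psi j) = (i == j)%:R)].

Definition finite_triple_products rho psi :=
  forall i j k, mu.-integrable setT
    (fun s => (psi i s * psi j s * psi k s * rho s)%:E).

Definition galerkin_mx rho psi (v : 'cV[R]_K) : 'M[R]_K :=
  \matrix_(i, j) \sum_(k < K)
    v k 0 * inner_prod rho (fun s => psi i s * psi j s) (psi k).

End galerkin.

Section linear_algebra.
Context {R : realType}.

Definition posdefmx m (M : 'M[R]_m) :=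
  M^T = M /\ forall x : 'cV[R]_m, x != 0 -> 0 < (x^T *m M *m x) 0 0.

Definition property_P1 m (P : 'cV[R]_m -> 'M[R]_m) :=
  exists V : 'M[R]_m, V *m V^T = 1%:M /\
    forall v, exists d : 'rV[R]_m, P v = V *m diag_mx d *m V^T.

Definition grad m (f : 'cV[R]_m -> R) (u : 'cV[R]_m) : 'cV[R]_m :=
  \col_i 'D_(delta_mx i 0) f u.

End linear_algebra.

(* The conservative variables (h, q) are the column vector u = col_mx h q, so
   that h = usubmx u and q = dsubmx u; [invmx] is the inverse only on
   invertible matrices, hence these functions are meaningful only where
   P(h) is positive definite. *)
Section entropy.
Context {R : realType} (K : nat).
Variables (P : 'cV[R]_K -> 'M[R]_K) (g : R) (b : 'cV[R]_K).
Variable alpha : 'cV[R]_K -> 'cV[R]_K.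

Implicit Type u : 'cV[R]_(K + K).
Local Notation h u := (usubmx u).
Local Notation q u := (dsubmx u).
Local Notation iP v := (invmx (P v)).

Definition sw_velocity u : 'cV[R]_K := iP (h u) *m q u.

Definition sw_entropy u : R :=
  2^-1 * (((q u)^T *m iP (h u) *m q u) 0 0 + g * ((h u)^T *m h u) 0 0)
  + g * ((h u)^T *m b) 0 0.

Definition sw_entropy_flux u : R :=
  2^-1 * ((sw_velocity u)^T *m P (q u) *m sw_velocity u) 0 0
  + g * ((q u)^T *m h u) 0 0 + g * ((q u)^T *m b) 0 0.

Definition sw_flux u : 'cV[R]_(K + K) :=
  col_mx (q u)
    (P (q u) *m iP (h u) *m q u + (2^-1 * g) *: (P (h u) *m h u)).

Local Notation a u := (alpha (h u)).

Definition roe_beta u : 'cV[R]_K := iP (a u) *m q u.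

Definition sw_entropy_roe u : R :=
  2^-1 * (g * ((a u)^T *m (P (a u))^T *m P (a u) *m a u) 0 0
          + ((roe_beta u)^T *m roe_beta u) 0 0)
  + g * ((a u)^T *m P (a u) *m b) 0 0.

Definition sw_entropy_flux_roe u : R :=
  2^-1 * ((roe_beta u)^T *m P (roe_beta u) *m iP (a u) *m roe_beta u) 0 0
  + g * ((a u)^T *m (P (a u) *m P (a u)) *m roe_beta u) 0 0
  + g * ((roe_beta u)^T *m P (a u) *m b) 0 0.

Definition sw_flux_roe u : 'cV[R]_(K + K) :=
  col_mx (q u)
    (P (iP (a u) *m q u) *m iP (a u) *m q u
     + (2^-1 * g) *: (P (P (a u) *m a u) *m P (a u) *m a u)).

Definition sw_entropy_var u := grad sw_entropy u.
Definition sw_entropy_var_roe u := grad sw_entropy_roe u.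

Definition sw_potential u : R :=
  ((sw_entropy_var u)^T *m sw_flux u) 0 0 - sw_entropy_flux u.
Definition sw_potential_roe u : R :=
  ((sw_entropy_var_roe u)^T *m sw_flux_roe u) 0 0 - sw_entropy_flux_roe u.

End entropy.

(* Main.v *)
Require Import Defs.
From HB Require Import structures.
From mathcomp Require Import all_boot all_order all_algebra.
From mathcomp Require Import all_classical all_reals all_analysis.

Set Implicit Arguments.
Unset Strict Implicit.
Unset Printing Implicit Defensive.

Import Order.TTheory GRing.Theory Num.Theory.
Import numFieldNormedType.Exports.

Local Open Scope classical_set_scope.
Local Open Scope ring_scope.

(** The Roe variables turn out to be a change of coordinates that is compatible
    with the Galerkin matrices.  Diagonalizing all P(v) in one orthonormal
    basis makes them commute, and commutation together with the symmetry
    P(v) w = P(w) v gives P(P(v) w) = P(v) P(w) ([galerkin_mulmx]): both sides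
    send z to P(v) P(w) z.  Hence, with A = P(alpha), the equation
    A alpha = h yields P(h) = A ^ 2, and q = A beta yields
    P(q) = A P(beta).  Substituting these in the entropy, the entropy flux and
    the flux, and cancelling A against its inverse, gives the Roe forms
    ([sw_entropy_roeE], [sw_entropy_flux_roeE], [sw_flux_roeE]).

    The entropy variables are gradients, so equality of the entropies is needed
    on a neighbourhood and not only at one point.  In the common eigenbasis the
    eigenvalues of P(h) are linear in h, hence positive definiteness is an open
    condition ([near_posdefmx_galerkin]).  The same eigenvalues give an explicit
    inverse of P(h) on this neighbourhood, with differentiable entries
    ([differentiable_invmx_galerkin]); the entropy is thus differentiable, the
    gradients agree, and the potentials agree because every term in them
    does. *)

(** * Commuting Galerkin matrices and the Roe variables *)

Section symmetric_algebra.
Context {R : comNzRingType} {K : nat} (P : 'cV[R]_K -> 'M[R]_K).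
Hypothesis P_swap : forall v w, P v *m w = P w *m v.
Hypothesis P_comm : forall v w, P v *m P w = P w *m P v.

(** Both sides agree on every vector z, because
    P(P(v) w) z = P(z) P(v) w = P(v) P(z) w = P(v) P(w) z. *)
Lemma galerkin_mulmx v w : P (P v *m w) = P v *m P w.
Proof.
have eqcol (M N : 'M[R]_K) :
    (forall j, M *m delta_mx j 0 = N *m delta_mx j 0 :> 'cV_K) -> M = N.
  move=> MN; apply/matrixP => i j.
  by have /matrixP/(_ i 0) := MN j; rewrite -!colE !mxE.
apply: eqcol => j.
by rewrite P_swap mulmxA P_comm -mulmxA (P_swap _ w) mulmxA.
Qed.

End symmetric_algebra.

Lemma invmx_mul (R : comUnitRingType) n (A B : 'M[R]_n) :
  A \in unitmx -> B \in unitmx -> invmx (A *m B) = invmx B *m invmx A.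
Proof.
move=> Au Bu; have ABu : A *m B \in unitmx by rewrite unitmx_mul Au.
apply: (can_inj (mulKmx ABu)); rewrite mulmxV //.
by rewrite mulmxA mulmxK // mulmxV.
Qed.

Section roe_form.
Context {R : realType} {K : nat} (P : 'cV[R]_K -> 'M[R]_K).
Variables (g : R) (b : 'cV[R]_K) (alpha : 'cV[R]_K -> 'cV[R]_K).
Hypothesis P_sym : forall v, (P v)^T = P v.
Hypothesis P_swap : forall v w, P v *m w = P w *m v.
Hypothesis P_comm : forall v w, P v *m P w = P w *m P v.

Variable u : 'cV[R]_(K + K).
Local Notation h := (usubmx u).
Local Notation q := (dsubmx u).
Local Notation a := (alpha h).
Local Notation A := (P a).
Local Notation beta := (roe_beta P alpha u).

Hypothesis alpha_root : P a *m a = h.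
Hypothesis Au : A \in unitmx.

Let mulA v w : P (P v *m w) = P v *m P w.
Proof. exact: galerkin_mulmx. Qed.

Let iP_h : invmx (P h) = invmx A *m invmx A.
Proof. by rewrite -[in LHS]alpha_root mulA invmx_mul. Qed.

Let q_beta : q = A *m beta.
Proof. by rewrite mulKVmx. Qed.

Let tr_iA : (invmx A)^T = invmx A.
Proof. by rewrite trmx_inv P_sym. Qed.

Let velocityE : sw_velocity P u = invmx A *m beta.
Proof. by rewrite /sw_velocity iP_h -mulmxA. Qed.

Lemma sw_entropy_roeE : sw_entropy P g b u = sw_entropy_roe P g b alpha u.
Proof.
have tr_h : a^T *m A = h^T by rewrite -[in RHS]alpha_root trmx_mul P_sym.
rewrite /sw_entropy /sw_entropy_roe P_sym tr_h -(mulmxA h^T) alpha_root.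
rewrite [X in _ * X + _]addrC; congr (_ * (_ + _) + _).
congr (fun_of_matrix _ 0 0).
by rewrite iP_h /roe_beta trmx_mul tr_iA !mulmxA.
Qed.

Lemma sw_entropy_flux_roeE :
  sw_entropy_flux P g b u = sw_entropy_flux_roe P g b alpha u.
Proof.
have tr_q : q^T = beta^T *m A by rewrite {1}q_beta trmx_mul P_sym.
rewrite /sw_entropy_flux /sw_entropy_flux_roe velocityE tr_q.
congr (_ * _ + _ * _ + _).
- congr (fun_of_matrix _ 0 0).
  rewrite [in P q]q_beta mulA trmx_mul tr_iA -!mulmxA.
  by rewrite mulKmx.
- have tr00 (M : 'M[R]_1) : M 0 0 = M^T 0 0 by rewrite mxE.
  rewrite [RHS]tr00 !trmx_mul !P_sym trmxK; congr (fun_of_matrix _ 0 0).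
  by rewrite -!mulmxA alpha_root.
Qed.

(** The momentum components are P(q) P(h)^-1 q and P(beta) beta; writing
    P(q) = A P(beta) = P(beta) A, the factor A cancels one inverse of A and the
    other one turns q into beta. *)
Lemma sw_flux_roeE : sw_flux P g u = sw_flux_roe P g alpha u.
Proof.
rewrite /sw_flux /sw_flux_roe alpha_root -!mulmxA alpha_root.
congr (col_mx _ (_ + _)).
rewrite iP_h [in P q]q_beta mulA -/beta.
by rewrite -[invmx A *m invmx A *m q]mulmxA -/beta P_comm !mulmxA mulmxK.
Qed.
End roe_form.

(** * Differentiability of matrix-valued functions *)

Section differentiability.
Context {R : realType}.

(** The differential of f satisfies the expansion that characterizes the
    differential of f', since the remainder only has to be small near x. *)
Lemma near_eq_differentiable (V W : normedModType R) (f f' : V -> W) (x : V) :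
  (\near x, f x = f' x) -> differentiable f x -> differentiable f' x.
Proof.
move=> ff' dfx.
have f'o : f' \o shift x = cst (f' x) + 'd f x +o_ 0 id.
  have /eqaddoP fo := diff_locally dfx.
  apply/eqaddoP => e e0; rewrite -(nbhs_singleton ff').
  have {ff'} : \forall y \near 0, f (y + x) = f' (y + x).
    by move: ff'; rewrite (near_shift 0 x) /= subr0.
  by apply: filterS2 (fo e e0) => y; rewrite !fctE /= => + <-.
have dfc : continuous ('d f x) by exact: diff_continuous.
by apply/diff_locallyP; rewrite (diff_unique dfc f'o).
Qed.

Context {V : normedModType R}.

(** Stated entry by entry, so that every rule below reduces to the rule for
    scalar functions. *)
Definition differentiable_mx m n (F : V -> 'M[R]_(m, n)) (x : V) :=
  forall i j, differentiable (fun y => F y i j : R) x.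

Lemma differentiable_mx_cst m n (A : 'M[R]_(m, n)) (x : V) :
  differentiable_mx (fun=> A) x.
Proof. by move=> i j; exact: (differentiable_cst (A i j)). Qed.

Lemma differentiable_mx_tr m n (F : V -> 'M[R]_(m, n)) (x : V) :
  differentiable_mx F x -> differentiable_mx (fun y => (F y)^T) x.
Proof.
move=> dF i j; rewrite (_ : (fun _ => _) = (fun y => F y j i)) //.
by apply/funext => y; rewrite mxE.
Qed.

Lemma differentiable_mx_mul m n p (F : V -> 'M[R]_(m, n))
    (G : V -> 'M[R]_(n, p)) (x : V) :
  differentiable_mx F x -> differentiable_mx G x ->
  differentiable_mx (fun y => F y *m G y) x.
Proof.
move=> dF dG i j.
rewrite (_ : (fun _ => _) =
    \sum_(k < n) ((fun y => F y i k) * (fun y => G y k j))); last first.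
  by apply/funext => y; rewrite mxE fct_sumE.
by apply: differentiable_sum => k; exact: differentiableM.
Qed.

Lemma differentiable_mx_diag n (F : V -> 'rV[R]_n) (x : V) :
  differentiable_mx F x -> differentiable_mx (fun y => diag_mx (F y)) x.
Proof.
move=> dF i j; have [<-|neq_ij] := eqVneq i j.
  rewrite (_ : (fun _ => _) = (fun y => F y 0 i)) //.
  by apply/funext => y; rewrite mxE eqxx.
rewrite (_ : (fun _ => _) = cst 0); first exact: differentiable_cst.
by apply/funext => y; rewrite mxE (negPf neq_ij).
Qed.

End differentiability.

(** * Matrices diagonal in a given orthonormal basis *)

Section orthogonal_diagonalization.
Context {R : realType} {m : nat} (V : 'M[R]_m).
Hypothesis V_orth : V *m V^T = 1%:M.

Let V_orth' : V^T *m V = 1%:M. Proof. exact: mulmx1C. Qed.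

(** Reads the eigenvalues off the matrix by a linear formula, so that they depend
    on the matrix as smoothly as its entries do. *)
Lemma diag_conjE (d : 'rV[R]_m) (M : 'M[R]_m) :
  M = V *m diag_mx d *m V^T -> d = \row_i (V^T *m M *m V) i i.
Proof.
move=> ->; apply/rowP => i.
by rewrite mxE !mulmxA V_orth' mul1mx -mulmxA V_orth' mulmx1 mxE eqxx.
Qed.

(** Testing the quadratic form on the i-th column of V isolates the i-th
    eigenvalue; conversely the form is a sum of squares weighted by the
    eigenvalues, in the coordinates V^T x. *)
Lemma posdefmx_diag (d : 'rV[R]_m) :
  posdefmx (V *m diag_mx d *m V^T) <-> forall i, 0 < d 0 i.
Proof.
split=> [[_ pos] i|d_gt0].
  have Vi_neq0 : col i V != 0.
    apply/eqP => /colP Vi0; have /matrixP/(_ i i)/eqP := V_orth'.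
    rewrite !mxE eqxx big1 ?[0 == _]eq_sym ?oner_eq0 // => k _.
    by have := Vi0 k; rewrite !mxE => ->; rewrite mul0r.
  have := pos _ Vi_neq0; rewrite colE trmx_mul !mulmxA.
  rewrite -(mulmxA _ V^T V) V_orth' mulmx1 -(mulmxA _ V^T V) V_orth' mulmx1.
  by rewrite trmx_delta -rowE -colE !mxE eqxx.
split=> [|x x_neq0]; first by rewrite !trmx_mul trmxK tr_diag_mx mulmxA.
pose y := V^T *m x.
have y_neq0 : y != 0.
  apply: contra_neq x_neq0 => y0; rewrite -[x]mul1mx -V_orth -mulmxA.
  by rewrite -/y y0 mulmx0.
have -> : x^T *m (V *m diag_mx d *m V^T) *m x = y^T *m (diag_mx d *m y).
  by rewrite /y trmx_mul trmxK !mulmxA.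
have -> : (y^T *m (diag_mx d *m y)) 0 0 = \sum_i d 0 i * y i 0 ^+ 2.
  rewrite mxE; apply: eq_bigr => i _.
  by rewrite mul_diag_mx !mxE mulrCA expr2.
have term_ge0 i : true -> 0 <= d 0 i * y i 0 ^+ 2.
  by rewrite mulr_ge0 ?sqr_ge0 // ltW.
rewrite lt_neqAle eq_sym; apply/andP; split; last exact: sumr_ge0.
rewrite psumr_eq0 //.
apply: contra y_neq0 => /allP d0; apply/eqP/colP => i; rewrite [RHS]mxE.
have := d0 i (mem_index_enum _).
by rewrite mulf_eq0 gt_eqF // expf_eq0 /= => /eqP.
Qed.

Lemma invmx_diag_conj (d : 'rV[R]_m) : (forall i, 0 < d 0 i) ->
  invmx (V *m diag_mx d *m V^T) =
    V *m diag_mx (\row_i (d 0 i)^-1) *m V^T.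
Proof.
move=> d_gt0; set M := V *m diag_mx d *m V^T.
have MB : M *m (V *m diag_mx (\row_i (d 0 i)^-1) *m V^T) = 1%:M.
  rewrite !mulmxA -(mulmxA _ V^T V) V_orth' mulmx1 -(mulmxA V) mulmx_diag.
  rewrite (_ : diag_mx _ = 1%:M) ?mulmx1 //.
  rewrite -diag_const_mx; congr diag_mx; apply/rowP => i.
  by rewrite !mxE divff // gt_eqF.
have [Mu _] := mulmx1_unit MB.
by apply: (can_inj (mulKmx Mu)); rewrite MB mulmxV.
Qed.

End orthogonal_diagonalization.

(** * The stochastic Galerkin matrix *)

Section galerkin_facts.
Context {R : realType} {n K : nat}.
Variables (rho : euclidean R n -> R) (psi : 'I_K -> euclidean R n -> R).
Local Notation P := (galerkin_mx rho psi).

Lemma galerkin_mx_sym v : (P v)^T = P v.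
Proof.
apply/matrixP => i j; rewrite !mxE; apply: eq_bigr => k _.
congr (_ * inner_prod _ _ _); apply/funext => s; exact: mulrC.
Qed.

(** The triple product of the basis functions i, j, k is symmetric in j and k,
    so the double sum is unchanged by exchanging v and w. *)
Lemma galerkin_mx_swap v w : P v *m w = P w *m v.
Proof.
apply/colP => i; rewrite !mxE.
under eq_bigr do rewrite mxE mulr_suml.
under [RHS]eq_bigr do rewrite mxE mulr_suml.
rewrite exchange_big /=; apply: eq_bigr => j _; apply: eq_bigr => k _.
rewrite mulrC mulrA [RHS]mulrAC.
congr (_ * _); rewrite /inner_prod; congr (Rintegral _ _ _).
by apply/funext => s; congr (_ * _); rewrite mulrAC.
Qed.

Lemma differentiable_galerkin_mx (u : 'cV[R]_(K + K)) :
  differentiable_mx (fun w => P (usubmx w)) u.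
Proof.
move=> i j.
rewrite (_ : (fun _ => _) = \sum_(k < K)
    ((fun w : 'cV[R]_(K + K) => w (lshift K k) 0 : R) *
    cst (inner_prod rho (fun s => psi i s * psi j s) (psi k)))); last first.
  apply/funext => w; rewrite mxE fct_sumE; apply: eq_bigr => k _.
  by rewrite mxE.
apply: differentiable_sum => k; apply: differentiableM.
  exact: differentiable_coord.
exact: differentiable_cst.
Qed.

End galerkin_facts.

(** * Simultaneous diagonalization: openness and smoothness *)

Section common_eigenbasis.
Context {R : realType} {n K : nat}.
Variables (rho : euclidean R n -> R) (psi : 'I_K -> euclidean R n -> R).
Local Notation P := (galerkin_mx rho psi).
Variable V : 'M[R]_K.
Hypothesis V_orth : V *m V^T = 1%:M.
Hypothesis P_diag : forall v, exists d : 'rV[R]_K, P v = V *m diag_mx d *m V^T.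

(** Diagonal of P(v) in the common eigenbasis: the eigenvalues that [P_diag]
    provides, in a form that shows their linear dependence on P(v). *)
Definition galerkin_eigen v : 'rV[R]_K := \row_i (V^T *m P v *m V) i i.

Lemma galerkin_eigenE v :
  P v = V *m diag_mx (galerkin_eigen v) *m V^T.
Proof.
by have [d Pd] := P_diag v; rewrite /galerkin_eigen -(diag_conjE V_orth Pd).
Qed.

Lemma galerkin_mx_comm v w : P v *m P w = P w *m P v.
Proof.
have VV : V^T *m V = 1%:M by exact: mulmx1C.
rewrite (galerkin_eigenE v) (galerkin_eigenE w) !mulmxA.
rewrite -!(mulmxA _ V^T V) VV !mulmx1 -!(mulmxA V).
by rewrite (diag_mxC (galerkin_eigen v)).
Qed.

Lemma differentiable_galerkin_eigen (u : 'cV[R]_(K + K)) :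
  differentiable_mx (fun w => galerkin_eigen (usubmx w)) u.
Proof.
move=> i j; rewrite (_ : (fun _ => _) =
    fun w : 'cV_(K + K) => (V^T *m P (usubmx w) *m V) j j); last first.
  by apply/funext => w; rewrite mxE.
apply: differentiable_mx_mul; last exact: differentiable_mx_cst.
apply: differentiable_mx_mul; first exact: differentiable_mx_cst.
exact: differentiable_galerkin_mx.
Qed.

(** Finitely many eigenvalues, each continuous in h, have to stay positive. *)
Lemma near_posdefmx_galerkin (u : 'cV[R]_(K + K)) :
  posdefmx (P (usubmx u)) -> \near u, posdefmx (P (usubmx u)).
Proof.
rewrite galerkin_eigenE => /(posdefmx_diag V_orth) d_gt0.
have d_near i : \forall w \near u, 0 < galerkin_eigen (usubmx w) 0 i.
  have /differentiable_continuous := differentiable_galerkin_eigen u 0 i.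
  by move/cvgr_gt; apply.
apply: filterS (filter_forall _ d_near) => w d_w.
by rewrite /= galerkin_eigenE; apply/posdefmx_diag.
Qed.

(** Near u the inverse is the conjugate of the diagonal matrix of reciprocal
    eigenvalues; away from the invertible matrices [invmx] does not follow this
    formula, hence the passage through a neighbourhood. *)
Lemma differentiable_invmx_galerkin (u : 'cV[R]_(K + K)) :
  posdefmx (P (usubmx u)) ->
  differentiable_mx (fun w => invmx (P (usubmx w))) u.
Proof.
move=> Pu i j.
pose F (w : 'cV[R]_(K + K)) :=
  V *m diag_mx (\row_k (galerkin_eigen (usubmx w) 0 k)^-1) *m V^T.
apply: (@near_eq_differentiable _ _ _ (fun w => F w i j)).
  apply: filterS (near_posdefmx_galerkin Pu) => w.
  rewrite galerkin_eigenE => /(posdefmx_diag V_orth) d_gt0.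
  by rewrite invmx_diag_conj.
apply: differentiable_mx_mul; last exact: differentiable_mx_cst.
apply: differentiable_mx_mul; first exact: differentiable_mx_cst.
apply: differentiable_mx_diag => k l.
rewrite (_ : (fun _ => _) =
    fun w : 'cV_(K + K) => (galerkin_eigen (usubmx w) 0 l)^-1); last first.
  by apply/funext => w; rewrite mxE.
apply: differentiableV; first exact: differentiable_galerkin_eigen.
by move: Pu; rewrite galerkin_eigenE => /(posdefmx_diag V_orth)/(_ l)/gt_eqF ->.
Qed.

Lemma differentiable_sw_entropy (g : R) (b : 'cV[R]_K) (u : 'cV[R]_(K + K)) :
  posdefmx (P (usubmx u)) -> differentiable (sw_entropy P g b) u.
Proof.
move=> Pu.
have dh : differentiable_mx (fun w : 'cV[R]_(K + K) => usubmx w) u.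
  move=> i j; rewrite (_ : (fun _ => _) =
    fun w : 'cV_(K + K) => w (lshift K i) j); first exact: differentiable_coord.
  by apply/funext => w; rewrite mxE.
have dq : differentiable_mx (fun w : 'cV[R]_(K + K) => dsubmx w) u.
  move=> i j; rewrite (_ : (fun _ => _) =
    fun w : 'cV_(K + K) => w (rshift K i) j); first exact: differentiable_coord.
  by apply/funext => w; rewrite mxE.
have dqPq := differentiable_mx_mul (differentiable_mx_mul
  (differentiable_mx_tr dq) (differentiable_invmx_galerkin Pu)) dq.
have dhh := differentiable_mx_mul (differentiable_mx_tr dh) dh.
have dhb := differentiable_mx_mul (differentiable_mx_tr dh)
  (differentiable_mx_cst b u).
exact: differentiableD (differentiableZ 2^-1 (differentiableD (dqPq 0 0)
  (differentiableZ g (dhh 0 0)))) (differentiableZ g (dhb 0 0)).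
Qed.

End common_eigenbasis.

Theorem theorem3p2 (R : realType) (n K : nat)
    (rho : euclidean R n -> R) (psi : 'I_K -> euclidean R n -> R)
    (g : R) (b : 'cV[R]_K) (alpha : 'cV[R]_K -> 'cV[R]_K) :
  let P := galerkin_mx rho psi in
  probability_density rho ->
  orthonormal_basis rho psi ->
  finite_triple_products rho psi ->
  0 < g ->
  property_P1 P ->
  (forall h, posdefmx (P h) ->
     P (alpha h) *m alpha h = h /\ P (alpha h) \in unitmx) ->
  forall u : 'cV[R]_(K + K), posdefmx (P (usubmx u)) ->
  [/\ sw_entropy P g b u = sw_entropy_roe P g b alpha u
        /\ sw_entropy_flux P g b u = sw_entropy_flux_roe P g b alpha u,
      differentiable (sw_entropy P g b) u
        /\ differentiable (sw_entropy_roe P g b alpha) u,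
      sw_entropy_var P g b u = sw_entropy_var_roe P g b alpha u
    & sw_potential P g b u = sw_potential_roe P g b alpha u].
Proof.
move=> P _ _ _ _ [V [V_orth P_diag]] alphaP u Pu.
have P_sym := galerkin_mx_sym rho psi.
have P_swap := galerkin_mx_swap rho psi.
have P_comm := galerkin_mx_comm V_orth P_diag.
have entropyE w : posdefmx (P (usubmx w)) ->
    sw_entropy P g b w = sw_entropy_roe P g b alpha w.
  by move=> /alphaP[]; exact: sw_entropy_roeE.
have entropy_near :
    \near u, sw_entropy P g b u = sw_entropy_roe P g b alpha u.
  exact: filterS entropyE (near_posdefmx_galerkin V_orth P_diag Pu).
have entropy_diff : differentiable (sw_entropy P g b) u.
  exact: differentiable_sw_entropy V_orth P_diag _ _ _ Pu.
have [alpha_root Au] := alphaP _ Pu.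
have fluxE : sw_entropy_flux P g b u = sw_entropy_flux_roe P g b alpha u.
  exact: sw_entropy_flux_roeE.
have varE : sw_entropy_var P g b u = sw_entropy_var_roe P g b alpha u.
  by apply/colP => i; rewrite !mxE; exact: near_eq_derive.
split=> //.
- by split; [exact: entropyE|].
- by split=> //; exact: near_eq_differentiable entropy_diff.
- rewrite /sw_potential /sw_potential_roe varE fluxE.
  by rewrite (sw_flux_roeE g P_swap P_comm alpha_root Au).
Qed.
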